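(* Let $L \in \mathbb{R}^{n\times n}$ be the combinatorial directed Laplacian of a directed weighted graph on $n$ vertices, and assume $L$ is diagonalizable, $L=V\Lambda V^{-1}$, with right eigenvectors $v_1,\dots,v_n$ (the columns of the invertible matrix $V\in\mathbb{C}^{n\times n}$). Let $\Omega\subset\{1,\dots,n\}$ be an index set of size $K\ge 1$, let $V_\Omega := [v_k]_{k\in\Omega}\in\mathbb{C}^{n\times K}$, and let $B_\Omega$ be the column span of $V_\Omega$. Let $M\subseteq\{1,\dots,n\}$ be a set of $m$ vertices with restriction operator $P_M\in\{0,1\}^{m\times n}$. Suppose $x = V_\Omega c\in B_\Omega$ for some $c\in\mathbb{C}^K$ and that $B:=P_MV_\Omega$ has full column rank $K$. Then $x$ is uniquely determined by $y=P_Mx$ (that is, $x$ is the only element $x'$ of $B_\Omega$ with $P_Mx'=y$), and $x$ is recovered by $$\hat{c} = B^{\dagger}y,\qquad \hat{x}=V_\Omega\hat{c},$$ i.e. $\hat{x}=x$.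
   Context: Directed Laplacian: for a directed weighted graph on vertex set $\{1,\dots,n\}$ with real edge weights $w(i,j)$, the adjacency matrix $A\in\mathbb{R}^{n\times n}$ has $A_{ij}=w(i,j)$ if $(i,j)$ is an edge (oriented $i\to j$) and $A_{ij}=0$ otherwise; the out-degrees are $d_i^{\mathrm{out}}=\sum_{j=1}^n A_{ij}$, $D_{\mathrm{out}}=\operatorname{diag}(d_1^{\mathrm{out}},\dots,d_n^{\mathrm{out}})$, and $L := D_{\mathrm{out}}-A$. The eigenvectors $v_k$ satisfy $Lv_k=\lambda_kv_k$ and need not be orthogonal or normalized; $\Lambda=\operatorname{diag}(\lambda_1,\dots,\lambda_n)$. The set $\Omega$ is thought of as indexing modes with small $|\lambda_k|$, and signals in $B_\Omega$ are called $\Omega$-bandlimited. The operator $P_M$ extracts from a vector in $\mathbb{C}^n$ the entries indexed by $M$. $B^\dagger$ is the Moore–Penrose pseudoinverse of $B$. In this statement $\hat{x}$ denotes the reconstructed signal. *)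

(* Defs.v *)
From HB Require Import structures.
From mathcomp Require Import all_boot all_order all_algebra.
From mathcomp Require Export complex.
From mathcomp Require Import reals.

Set Implicit Arguments.
Unset Strict Implicit.
Unset Printing Implicit Defensive.

Import Order.TTheory GRing.Theory Num.Theory.
Local Open Scope ring_scope.

(* Self-loops are allowed; they do not affect the Laplacian. *)
Record wdigraph (R : realType) (n : nat) := WDigraph {
  edge : rel 'I_n;
  weight : 'I_n -> 'I_n -> R
}.

Section Laplacian.
Variables (R : realType) (n : nat) (G : wdigraph R n).

Definition adjacency : 'M[R]_n :=
  \matrix_(i, j) if edge G i j then weight G i j else 0.

Definition outdeg (i : 'I_n) : R := \sum_(j < n) adjacency i j.

Definition laplacian : 'M[R]_n := diag_mx (\row_i outdeg i) - adjacency.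

End Laplacian.

Definition cols (F : fieldType) (m n : nat) (A : 'M[F]_(m, n)) (S : {set 'I_n})
    : 'M[F]_(m, #|S|) :=
  colsub enum_val A.

Definition restrict_mx (F : fieldType) (n : nat) (S : {set 'I_n})
    : 'M[F]_(#|S|, n) :=
  \matrix_(r, j) (j == enum_val r)%:R.

Definition colspan (F : fieldType) (m p : nat) (A : 'M[F]_(m, p))
    : {vspace 'cV[F]_m} :=
  <<[seq col k A | k : 'I_p]>>%VS.

Section MoorePenrose.
Variable C : numClosedFieldType.

Definition adjmx (m p : nat) (A : 'M[C]_(m, p)) : 'M[C]_(p, m) :=
  map_mx Num.conj A^T.

Definition penrose (m p : nat) (A : 'M[C]_(m, p)) (X : 'M[C]_(p, m)) : bool :=
  [&& A *m X *m A == A, X *m A *m X == X,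
      adjmx (A *m X) == A *m X & adjmx (X *m A) == X *m A].

Lemma adjmxM m p q (A : 'M[C]_(m, p)) (B : 'M[C]_(p, q)) :
  adjmx (A *m B) = adjmx B *m adjmx A.
Proof. by rewrite /adjmx trmx_mul map_mxM. Qed.

Lemma adjmxK m p (A : 'M[C]_(m, p)) : adjmx (adjmx A) = A.
Proof. by apply/matrixP=> i j; rewrite !mxE conjCK. Qed.

Lemma adjmx1 n : adjmx (1%:M : 'M[C]_n) = 1%:M.
Proof. by rewrite /adjmx trmx1 map_mx1. Qed.

Lemma mulmx_adj_eq0 m (u : 'rV[C]_m) : u *m adjmx u = 0 -> u = 0.
Proof.
move/matrixP/(_ 0 0); rewrite !mxE => /eqP.
rewrite psumr_eq0 => [/allP u0|j _]; last by rewrite !mxE mul_conjC_ge0.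
apply/rowP=> j; have := u0 j (mem_index_enum j).
by rewrite !mxE mul_conjC_eq0 => /eqP.
Qed.

Lemma gram_unit m p (A : 'M[C]_(m, p)) :
  row_free A -> A *m adjmx A \in unitmx.
Proof.
move=> Afree; rewrite -row_free_unit -kermx_eq0; apply/eqP/row_matrixP=> i.
rewrite row0; set u := row i _.
have u0 : u *m (A *m adjmx A) = 0.
  by rewrite -row_mul mulmx_ker row0.
have: (u *m A) *m adjmx (u *m A) = 0.
  by rewrite adjmxM !mulmxA -[u *m A *m _]mulmxA u0 mul0mx.
by move/mulmx_adj_eq0/eqP; rewrite mulmx_free_eq0 // => /eqP.
Qed.

Lemma penrose_exists m p (A : 'M[C]_(m, p)) : exists X, penrose A X.
Proof.
have [r [E [F [defA EU FU]]]] : exists r (E : 'M_(m, r)) (F : 'M_(r, p)),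
  [/\ A = E *m F, adjmx E *m E \in unitmx & F *m adjmx F \in unitmx].
- exists (\rank A), (col_base A), (row_base A); split.
  + by rewrite mulmx_base.
  + have := @gram_unit _ _ (adjmx (col_base A)); rewrite adjmxK; apply.
    rewrite /row_free /adjmx mxrank_map mxrank_tr; exact: col_base_full.
  + by rewrite gram_unit ?row_base_free.
pose E' := invmx (adjmx E *m E) *m adjmx E.
pose F' := adjmx F *m invmx (F *m adjmx F).
have EE : E' *m E = 1%:M by rewrite -mulmxA mulVmx.
have FF : F *m F' = 1%:M by rewrite mulmxA mulmxV.
have adjV k (S : 'M[C]_k) : adjmx S = S -> adjmx (invmx S) = invmx S.
  by move=> hS; rewrite /adjmx trmx_inv map_invmx -/(adjmx S) hS.
have AX : A *m (F' *m E') = E *m E'.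
  by rewrite defA -mulmxA (mulmxA F) FF mul1mx.
have XA : F' *m E' *m A = F' *m F.
  by rewrite defA -mulmxA (mulmxA E') EE mul1mx.
exists (F' *m E'); rewrite /penrose AX XA; apply/and4P; split; apply/eqP.
- by rewrite defA -mulmxA (mulmxA E') EE mul1mx.
- by rewrite -mulmxA (mulmxA F) FF mul1mx.
- by rewrite /E' !adjmxM adjmxK adjV ?mulmxA // adjmxM adjmxK.
- by rewrite /F' !adjmxM adjmxK adjV ?mulmxA // adjmxM adjmxK.
Qed.

Lemma penrose_uniq m p (A : 'M[C]_(m, p)) (X Y : 'M[C]_(p, m)) :
  penrose A X -> penrose A Y -> X = Y.
Proof.
case/and4P=> /eqP X1 /eqP X2 /eqP X3 /eqP X4.
case/and4P=> /eqP Y1 /eqP Y2 /eqP Y3 /eqP Y4.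
have eAX : A *m X = A *m Y.
  by rewrite -X3 -[in LHS]Y1 -[_ *m A *m X]mulmxA adjmxM X3 Y3 !mulmxA X1.
have eXA : X *m A = Y *m A.
  rewrite -X4 -[in LHS]Y1 -[A *m Y *m A]mulmxA mulmxA adjmxM X4 Y4.
  by rewrite -mulmxA (mulmxA A) X1.
by rewrite -X2 -mulmxA eAX mulmxA eXA Y2.
Qed.

Definition mpinv (m p : nat) (A : 'M[C]_(m, p)) : 'M[C]_(p, m) :=
  xchoose (penrose_exists A).

Lemma mpinvP m p (A : 'M[C]_(m, p)) : penrose A (mpinv A).
Proof. exact: xchooseP. Qed.

End MoorePenrose.

(* Main.v *)
Require Import Defs.
From mathcomp Require Import all_boot all_order all_algebra complex reals.

Import GRing.Theory Num.Theory.
Local Open Scope ring_scope.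

(** On [B_Omega], sampling acts on coefficients as the matrix [B]: a signal [V_Omega *m c] has
    samples [B *m c]. Full column rank makes [B] injective, so the samples fix the coefficients and
    hence the signal. It also makes the pseudoinverse a left inverse ([mpinv_mulVmx]), so [chat] is
    [c] itself. [colspanP] supplies coefficients for an arbitrary competitor in the span. *)

Lemma colspanP (F : fieldType) (m p : nat) (A : 'M[F]_(m, p)) (u : 'cV[F]_m) :
  reflect (exists c : 'cV[F]_p, u = A *m c) (u \in colspan A).
Proof.
apply: (iffP idP) => [|[c ->]].
  (* Each column is [A] times a basis vector, so the span lies in the image of the linear map given
     by [A]. *)
  have /subvP/[apply] : (colspan A <= limg (linfun (@mulmx F m p 1 A)))%VS.
    apply/span_subvP=> _ /mapP[k _ ->].
    by rewrite colE -[A *m _]lfunE memv_img ?memvf.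
  by case/memv_imgP=> c _ ->; exists c; rewrite lfunE.
have -> : A *m c = \sum_k c k 0 *: col k A.
  apply/colP=> i; rewrite !mxE summxE; apply: eq_bigr => k _.
  by rewrite !mxE mulrC.
by apply: memv_suml => k _; apply/memvZ/memv_span/image_f.
Qed.

(** The Penrose equation [B *m X *m B = B] says that [B] maps [X *m B] and the identity to the same
    matrix; [row_full], that is full column rank, lets [B] be cancelled on the left. *)
Lemma mpinv_mulVmx (C : numClosedFieldType) (m p : nat) (B : 'M[C]_(m, p)) :
  row_full B -> mpinv B *m B = 1%:M.
Proof.
case/and4P: (mpinvP B) => /eqP BXB _ _ _ Bfull.
by apply: (row_full_inj Bfull); rewrite mulmxA mulmx1.
Qed.

Theorem theorem5p1 (R : realType) (n : nat) (G : wdigraph R n)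
    (V : 'M[R[i]]_n) (lambda : 'rV[R[i]]_n)
    (Omega M : {set 'I_n}) (x : 'cV[R[i]]_n) (c : 'cV[R[i]]_#|Omega|) :
  let L := map_mx (real_complex R) (laplacian G) in
  let V_Omega := cols V Omega in
  let B_Omega := colspan V_Omega in
  let P_M := restrict_mx R[i] M in
  let B := P_M *m V_Omega in
  let y := P_M *m x in
  V \in unitmx ->
  L = V *m diag_mx lambda *m invmx V ->
  (1 <= #|Omega|)%N ->
  x = V_Omega *m c ->
  \rank B = #|Omega| ->
  (forall x' : 'cV[R[i]]_n, x' \in B_Omega /\ P_M *m x' = y <-> x' = x) /\
  (let chat := mpinv B *m y in
   let xhat := V_Omega *m chat in
   xhat = x).
Proof.
move=> L V_Omega B_Omega P_M B y _ _ _ xE rkB.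
have Bfull : row_full B by rewrite /row_full rkB.
have yE : y = B *m c by rewrite /y xE mulmxA.
split; last by rewrite /= yE (mulmxA (mpinv B)) mpinv_mulVmx // mul1mx.
move=> x'; split=> [[/colspanP[c' ->]]|->].
  (* Equal samples mean [B *m c' = B *m c], and injectivity of [B] gives [c' = c]. *)
  by rewrite mulmxA yE xE => /(row_full_inj Bfull) ->.
by split=> //; apply/colspanP; exists c.
Qed.
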